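(* Let $R$ be a commutative ring, let $(A,\underline\sigma)$ be an $n$-twisted commutative $R$-algebra with endomorphisms $\sigma_{A,1},\ldots,\sigma_{A,n}$, and let $x_1,\ldots,x_n$ be $\underline\sigma$-coordinates of Schwarz type for $A$ over $R$. If an $A$-module $M$ is endowed with an integrable action of $\mathrm T_{A/R,\underline\sigma}$, then for all $i=1,\ldots,n$ the endomorphism of $M$ defined by $$\forall s\in M,\quad \sigma_{M,i}(s)=s-(x_i-\sigma_{A,i}(x_i))\,\partial_{M,i}(s)$$ is $\sigma_{A,i}$-linear, and this defines a functor $$\mathrm{MIC}(A,\underline\sigma)\to\underline\sigma_A\text{-}\mathrm{Mod}.$$ This functor is an equivalence of categories when the coordinates are strong.
   Context: An $n$-twisted commutative $R$-algebra is a commutative $R$-algebra with $n$ pairwise commuting $R$-algebra endomorphisms $\sigma_i=\sigma_{A,i}$. A $\sigma_i$-derivation of $A/R$ is an $R$-linear map $D:A\to A$ with $D(xy)=D(x)y+\sigma_i(x)D(y)$; a $\underline\sigma$-derivation is a finite sum of $\sigma_i$-derivations ($i=1,\dots,n$). $\mathrm T_{A/R,\underline\sigma}$ is the $A$-module of all $\underline\sigma$-derivations of $A/R$ (with $(xD)(y)=xD(y)$). Elements $x_1,\ldots,x_n\in A$ are $\underline\sigma$-coordinates for $A/R$ if (1) for each $i$ there is a unique $\sigma_i$-derivation $\partial_i$ of $A/R$ with $\partial_i(x_i)=1$ and $\partial_i(x_j)=0$ for $j\ne i$; and (2) every $\underline\sigma$-derivation $D$ satisfies $D=\sum_i D(x_i)\partial_i$.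 They are of Schwarz type if $\partial_i\partial_j=\partial_j\partial_i$ for all $i,j$ and $\sigma_i\partial_j=\partial_j\sigma_i$ for $i\neq j$. They are strong if $x_i-\sigma_i(x_i)\in A^\times$ for all $i$. An $R$-linear action of $\mathrm T_{A/R,\underline\sigma}$ on an $A$-module $M$ is a biadditive map $(D,s)\mapsto Ds$ with $(xD)s=x(Ds)$ for $x\in A$ and $D(as)=a(Ds)$ for $a\in R$. It is an action by derivations if every $\sigma_i$-derivation $D$ of $A$ acts by a $D$-derivation, i.e. $D(xs)=D(x)s+\sigma_i(x)Ds$ for $x\in A,s\in M$. Write $\partial_{M,i}(s)=\partial_i s$. Such an action is integrable if $\partial_{M,1},\ldots,\partial_{M,n}$ commute with each other. $\mathrm{MIC}(A,\underline\sigma)$ is the category of $A$-modules with an integrable $R$-linear action of $\mathrm T_{A/R,\underline\sigma}$ by derivations, with morphisms the $A$-linear maps commuting with the action. $\underline\sigma_A\text{-}\mathrm{Mod}$ is the category of $A$-modules $M$ with $n$ pairwise commuting additive maps $\sigma_{M,i}:M\to M$ that are $\sigma_{A,i}$-linear, i.e. $\sigma_{M,i}(xs)=\sigma_{A,i}(x)\sigma_{M,i}(s)$; morphisms are $A$-linear maps $u$ with $u\circ\sigma_{M,i}=\sigma_{N,i}\circ u$ for all $i$. *)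

(* Defs.v *)
From HB Require Import structures.
From mathcomp Require Import all_boot all_algebra.
From mathcomp Require Import boolp functions.

Set Implicit Arguments.
Unset Strict Implicit.
Unset Printing Implicit Defensive.

Import GRing.Theory.
Local Open Scope ring_scope.

Record category := Category {
  obj :> Type;
  mor : obj -> obj -> Type;
  idm : forall X, mor X X;
  compm : forall X Y Z, mor Y Z -> mor X Y -> mor X Z;
  compm_idl : forall X Y (f : mor X Y), compm (idm Y) f = f;
  compm_idr : forall X Y (f : mor X Y), compm f (idm X) = f;
  compmA : forall W X Y Z (h : mor Y Z) (g : mor X Y) (f : mor W X),
    compm h (compm g f) = compm (compm h g) f }.

Record functor (C D : category) := Functor {
  fobj :> C -> D;
  fmap : forall X Y, mor X Y -> mor (fobj X) (fobj Y);
  fmap_id : forall X, fmap (idm X) = idm (fobj X);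
  fmap_comp : forall X Y Z (g : mor Y Z) (f : mor X Y),
    fmap (compm g f) = compm (fmap g) (fmap f) }.

Definition functor_id (C : category) : functor C C :=
  @Functor C C id (fun _ _ => id) (fun _ => erefl) (fun _ _ _ _ _ => erefl).

Lemma functor_comp_id (C D E : category) (G : functor D E) (F : functor C D) X :
  fmap G (fmap F (idm X)) = idm (G (F X)).
Proof. by rewrite !fmap_id. Qed.

Lemma functor_comp_comp (C D E : category) (G : functor D E) (F : functor C D)
    X Y Z (g : mor Y Z) (f : mor X Y) :
  fmap G (fmap F (compm g f)) = compm (fmap G (fmap F g)) (fmap G (fmap F f)).
Proof. by rewrite !fmap_comp. Qed.

Definition functor_comp (C D E : category) (G : functor D E) (F : functor C D) :
    functor C E :=
  @Functor C E (fun X => G (F X)) (fun X Y f => fmap G (fmap F f))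
    (functor_comp_id G F) (@functor_comp_comp _ _ _ G F).

Definition is_iso (C : category) (X Y : C) (f : mor X Y) : Prop :=
  exists g : mor Y X, compm g f = idm X /\ compm f g = idm Y.

Definition naturally_isomorphic (C D : category) (F G : functor C D) : Prop :=
  exists eta : forall X, mor (F X) (G X),
    (forall X Y (f : mor X Y), compm (eta Y) (fmap F f) = compm (fmap G f) (eta X))
    /\ forall X, is_iso (eta X).

Definition is_equivalence (C D : category) (F : functor C D) : Prop :=
  exists G : functor D C,
    naturally_isomorphic (functor_comp G F) (functor_id C) /\
    naturally_isomorphic (functor_comp F G) (functor_id D).

(* The algebra structure is given by its structure morphism: [comAlgType R]
   would exclude the zero algebra. *)
Record twistedAlgebra (R : comPzRingType) (n : nat) := TwistedAlgebra {
  tw_ring :> comPzRingType;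
  tw_unit : {rmorphism R -> tw_ring};
  tw_sigma : 'I_n -> {rmorphism tw_ring -> tw_ring};
  tw_sigma_unit : forall i a, tw_sigma i (tw_unit a) = tw_unit a;
  tw_sigmaC : forall i j x,
    tw_sigma i (tw_sigma j x) = tw_sigma j (tw_sigma i x) }.

Section Derivations.
Variables (R : comPzRingType) (n : nat) (A : twistedAlgebra R n).

Definition sigma_derivation (i : 'I_n) (D : A -> A) : Prop :=
  [/\ {morph D : x y / x + y},
      forall a x, D (tw_unit A a * x) = tw_unit A a * D x &
      forall x y, D (x * y) = D x * y + tw_sigma A i x * D y].

(* [A -> A^o] is the A-module of all maps from A to A, [x *: D] being
   [fun y => x * D y]. *)
Definition twisted_derivation : {pred A -> A^o} := fun D =>
  `[< exists (m : nat) (k : 'I_m -> 'I_n) (E : 'I_m -> A -> A^o),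
        (forall j, sigma_derivation (k j) (E j)) /\ D = \sum_(j < m) E j >].

Lemma sigma_derivationZ i (c : A) (D : A -> A^o) :
  sigma_derivation i D -> sigma_derivation i (c *: D).
Proof.
case=> DD DZ DM; have cE y : (c *: D) y = c * D y :> A by [].
split=> [y z|a y|y z]; rewrite !cE.
- by rewrite DD; apply: mulrDr.
- by rewrite DZ mulrCA.
- by rewrite DM mulrDr mulrA (mulrCA c).
Qed.

Lemma twisted_derivation_submod_closed : submod_closed twisted_derivation.
Proof.
split=> [|c D D'].
  apply/asboolP.
  exists 0%N, (fun j : 'I_0 => False_rect 'I_n (notF (ltn_ord j))), (fun=> 0).
  by split=> [[]|]; rewrite ?big_ord0.
move=> /asboolP[m [k [E [dE ->]]]] /asboolP[m' [k' [E' [dE' ->]]]].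
apply/asboolP; exists (m + m')%N,
  (fun j : 'I_(m + m') =>
     match fintype.split j with inl l => k l | inr r => k' r end),
  (fun j : 'I_(m + m') =>
     match fintype.split j with inl l => c *: E l | inr r => E' r end).
split=> [j|]; first by case: (fintype.split j) => l; [apply: sigma_derivationZ|].
rewrite big_split_ord scaler_sumr /=; congr (_ + _); apply: eq_bigr => j _.
  by rewrite (unsplitK (inl j)).
by rewrite (unsplitK (inr j)).
Qed.

HB.instance Definition _ := GRing.isSubmodClosed.Build A (A -> A^o)
  twisted_derivation (GRing.submod_closed_semi twisted_derivation_submod_closed).

(* T_{A/R,sigma} *)
Record tangent := Tangent {
  tangent_fun :> A -> A^o;
  _ : tangent_fun \in twisted_derivation }.

HB.instance Definition _ := [isSub for tangent_fun].
HB.instance Definition _ := [Choice of tangent by <:].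
HB.instance Definition _ := [SubChoice_isSubLmodule of tangent by <:].

Definition is_partial (x : 'I_n -> A) (i : 'I_n) (d : tangent) : Prop :=
  sigma_derivation i d /\ forall j, d (x j) = (j == i)%:R.

Definition sigma_coordinates (x : 'I_n -> A) : Prop :=
  exists d : 'I_n -> tangent,
    (forall i, unique (is_partial x i) (d i)) /\
    forall D : tangent, D = \sum_(i < n) (D (x i) : A) *: d i.

Definition partial (x : 'I_n -> A) (hx : sigma_coordinates x) : 'I_n -> tangent :=
  projT1 (cid hx).

Definition schwarz_type (x : 'I_n -> A) (hx : sigma_coordinates x) : Prop :=
  (forall i j y, partial hx i (partial hx j y) = partial hx j (partial hx i y))
  /\ forall i j, i != j ->
     forall y, tw_sigma A i (partial hx j y) = partial hx j (tw_sigma A i y).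

Definition strong_coordinates (x : 'I_n -> A) : Prop :=
  forall i, exists y : A, (x i - tw_sigma A i (x i)) * y = 1.

End Derivations.

Lemma linear_ext (A : comPzRingType) (M N : lmodType A) (f g : {linear M -> N}) :
  f =1 g -> f = g.
Proof.
case: f g => f [[fD] [fZ]] [g [[gD] [gZ]]] /= /funext fg; subst g.
by rewrite (Prop_irrelevance fD gD) (Prop_irrelevance fZ gZ).
Qed.

Section MIC.
Variables (R : comPzRingType) (n : nat) (A : twistedAlgebra R n).

Record linear_action (M : lmodType A) (act : tangent A -> M -> M) : Prop :=
  LinearAction {
    actDl : forall D D' s, act (D + D') s = act D s + act D' s;
    actDr : forall D s s', act D (s + s') = act D s + act D s';
    actZl : forall (c : A) D s, act (c *: D) s = c *: act D s;
    actZr : forall (a : R) D s,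
      act D (tw_unit A a *: s) = tw_unit A a *: act D s }.

Definition acts_by_derivations (M : lmodType A) (act : tangent A -> M -> M) :=
  forall i (D : tangent A), sigma_derivation i D ->
  forall (c : A) s, act D (c *: s) = (D c : A) *: s + tw_sigma A i c *: act D s.

Variables (x : 'I_n -> A) (hx : sigma_coordinates x).

Definition integrable (M : lmodType A) (act : tangent A -> M -> M) :=
  forall i j s,
    act (partial hx i) (act (partial hx j) s) =
    act (partial hx j) (act (partial hx i) s).

Record mic_obj := MicObj {
  mic_module :> lmodType A;
  mic_act : tangent A -> mic_module -> mic_module;
  mic_act_linear : linear_action mic_act;
  mic_act_der : acts_by_derivations mic_act;
  mic_act_integrable : integrable mic_act }.

Record mic_hom (M N : mic_obj) := MicHom {
  mic_map :> {linear M -> N};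
  mic_mapP : forall D s, mic_map (mic_act D s) = mic_act D (mic_map s) }.

Lemma mic_hom_ext (M N : mic_obj) (f g : mic_hom M N) : f =1 g -> f = g.
Proof.
case: f g => f fP [g gP] /= /linear_ext fg; subst g.
by rewrite (Prop_irrelevance fP gP).
Qed.

Definition mic_id (M : mic_obj) : mic_hom M M :=
  @MicHom M M (idfun : {linear M -> M}) (fun _ _ => erefl).

Lemma mic_compP (M N P : mic_obj) (g : mic_hom N P) (f : mic_hom M N) D s :
  g (f (mic_act D s)) = mic_act D (g (f s)).
Proof. by rewrite !mic_mapP. Qed.

Definition mic_comp (M N P : mic_obj) (g : mic_hom N P) (f : mic_hom M N) :
    mic_hom M P :=
  @MicHom M P (g \o f : {linear M -> P}) (mic_compP g f).

Lemma mic_idl (M N : mic_obj) (f : mic_hom M N) : mic_comp (mic_id N) f = f.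
Proof. exact: mic_hom_ext. Qed.

Lemma mic_idr (M N : mic_obj) (f : mic_hom M N) : mic_comp f (mic_id M) = f.
Proof. exact: mic_hom_ext. Qed.

Lemma mic_compA (M N P Q : mic_obj) (h : mic_hom P Q) (g : mic_hom N P)
    (f : mic_hom M N) :
  mic_comp h (mic_comp g f) = mic_comp (mic_comp h g) f.
Proof. exact: mic_hom_ext. Qed.

Definition MIC : category := Category mic_idl mic_idr mic_compA.

Definition mic_sigma (M : MIC) (i : 'I_n) (s : M) : M :=
  s - (x i - tw_sigma A i (x i)) *: mic_act (partial hx i) s.

End MIC.

Arguments mic_sigma {R n A x hx} M i s.

Section TwistedModules.
Variables (R : comPzRingType) (n : nat) (A : twistedAlgebra R n).

Definition sigma_linear (i : 'I_n) (M : lmodType A) (f : M -> M) : Prop :=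
  linear_for (tw_sigma A i \; *:%R) f.

Record tmod_obj := TmodObj {
  tmod_module :> lmodType A;
  tmod_sigma : 'I_n -> tmod_module -> tmod_module;
  tmod_sigma_linear : forall i, sigma_linear i (tmod_sigma i);
  tmod_sigmaC : forall i j s,
    tmod_sigma i (tmod_sigma j s) = tmod_sigma j (tmod_sigma i s) }.

Record tmod_hom (M N : tmod_obj) := TmodHom {
  tmod_map :> {linear M -> N};
  tmod_mapP : forall i s,
    tmod_map (tmod_sigma i s) = tmod_sigma i (tmod_map s) }.

Lemma tmod_hom_ext (M N : tmod_obj) (f g : tmod_hom M N) : f =1 g -> f = g.
Proof.
case: f g => f fP [g gP] /= /linear_ext fg; subst g.
by rewrite (Prop_irrelevance fP gP).
Qed.

Definition tmod_id (M : tmod_obj) : tmod_hom M M :=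
  @TmodHom M M (idfun : {linear M -> M}) (fun _ _ => erefl).

Lemma tmod_compP (M N P : tmod_obj) (g : tmod_hom N P) (f : tmod_hom M N) i s :
  g (f (tmod_sigma i s)) = tmod_sigma i (g (f s)).
Proof. by rewrite !tmod_mapP. Qed.

Definition tmod_comp (M N P : tmod_obj) (g : tmod_hom N P) (f : tmod_hom M N) :
    tmod_hom M P :=
  @TmodHom M P (g \o f : {linear M -> P}) (tmod_compP g f).

Lemma tmod_idl (M N : tmod_obj) (f : tmod_hom M N) : tmod_comp (tmod_id N) f = f.
Proof. exact: tmod_hom_ext. Qed.

Lemma tmod_idr (M N : tmod_obj) (f : tmod_hom M N) : tmod_comp f (tmod_id M) = f.
Proof. exact: tmod_hom_ext. Qed.

Lemma tmod_compA (M N P Q : tmod_obj) (h : tmod_hom P Q) (g : tmod_hom N P)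
    (f : tmod_hom M N) :
  tmod_comp h (tmod_comp g f) = tmod_comp (tmod_comp h g) f.
Proof. exact: tmod_hom_ext. Qed.

Definition TwMod : category := Category tmod_idl tmod_idr tmod_compA.

End TwistedModules.

Section SigmaFunctor.
Variables (R : comPzRingType) (n : nat) (A : twistedAlgebra R n).
Variables (x : 'I_n -> A) (hx : sigma_coordinates x).
Hypothesis sigmaL : forall (M : MIC hx) i, sigma_linear i (mic_sigma M i).
Hypothesis sigmaC : forall (M : MIC hx) i j (s : M),
  mic_sigma M i (mic_sigma M j s) = mic_sigma M j (mic_sigma M i s).
Hypothesis sigma_hom : forall (M N : MIC hx) (f : mor M N) i (s : M),
  mic_map f (mic_sigma M i s) = mic_sigma N i (mic_map f s).

Definition sigma_fobj (M : MIC hx) : TwMod A :=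
  TmodObj (@sigmaL M) (@sigmaC M).

Definition sigma_fmap (M N : MIC hx) (f : mor M N) :
    mor (sigma_fobj M) (sigma_fobj N) :=
  @TmodHom _ _ A (sigma_fobj M) (sigma_fobj N) (mic_map f) (@sigma_hom M N f).

Lemma sigma_fmap_id (M : MIC hx) : sigma_fmap (idm M) = idm (sigma_fobj M).
Proof. exact: tmod_hom_ext. Qed.

Lemma sigma_fmap_comp (M N P : MIC hx) (g : mor N P) (f : mor M N) :
  sigma_fmap (compm g f) = compm (sigma_fmap g) (sigma_fmap f).
Proof. exact: tmod_hom_ext. Qed.

Definition sigma_functor : functor (MIC hx) (TwMod A) :=
  Functor sigma_fmap_id sigma_fmap_comp.

End SigmaFunctor.

(* Main.v *)
Require Import Defs.
From mathcomp Require Import all_boot all_algebra.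
From mathcomp Require Import boolp.

(** Write [h_i = x_i - sigma_i(x_i)] and [d_i] for the [i]-th partial derivation.
    Everything comes from expanding [d_i (x_i y) = d_i (y x_i)] by the twisted
    Leibniz rule in its two orders: since [A] is commutative, this yields
    [sigma_i = 1 - h_i d_i] on [A] ([tw_sigma_partial]).  The formula for
    [sigma_(M,i)] copies that identity on [M], and the Leibniz rule for the
    action turns it into [sigma_i]-linearity.  For [i != j] the Schwarz condition
    makes [h_j] a constant for [d_i] and for [sigma_i] ([partial_defect],
    [tw_sigma_defect]), so the coefficients [h_i] and [h_j] can be moved across
    the operators, and [sigma_(M,i) sigma_(M,j)] becomes an expression symmetric
    in [i] and [j].

    When every [h_i] has an inverse [g_i], the formula can be solved for the
    action: [d_(M,i) = g_i (1 - sigma_(M,i))], and [D = \sum_i D(x_i) d_i] forces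
    [D] to act as [\sum_i D(x_i) d_(M,i)].  The inverse functor equips a twisted
    module with this action and keeps the underlying modules and maps; both
    natural isomorphisms are identities on the underlying modules.  The point
    that needs care is that an arbitrary [sigma_i]-derivation [D] acts by
    [D]-derivations, since the sum involves all the [sigma_j]: commutativity of
    [A], used as above, shows that [D(x_j) = 0] for [j != i]
    ([sigma_derivation_coord0]), so that only the [i]-th term survives. *)

Set Implicit Arguments.
Unset Strict Implicit.
Unset Printing Implicit Defensive.

Import GRing.Theory.
Local Open Scope ring_scope.

(** * Twisted derivations and coordinates of the algebra *)

Section Coordinates.
Variables (R : comPzRingType) (n : nat) (A : twistedAlgebra R n).
Variables (x : 'I_n -> A) (hx : sigma_coordinates x).

Definition defect (i : 'I_n) : A := x i - tw_sigma A i (x i).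

Lemma partial_is_partial i : is_partial x i (partial hx i).
Proof. by rewrite /partial; case: cid => d /= [/(_ i)[]]. Qed.

Lemma partial_sigma_derivation i : sigma_derivation i (partial hx i).
Proof. by case: (partial_is_partial i). Qed.

Lemma partial_coord i j : partial hx i (x j) = (j == i)%:R.
Proof. by case: (partial_is_partial i). Qed.

Lemma tangent_decomp (D : tangent A) :
  D = \sum_(i < n) (D (x i) : A) *: partial hx i.
Proof. by rewrite /partial; case: cid => d /= [_]. Qed.

Lemma tangent_funD (D D' : tangent A) (y : A) :
  (D + D') y = D y + D' y.
Proof. by []. Qed.

Lemma tangent_sumE (I : Type) (r : seq I) (c : I -> A) (D : I -> tangent A)
    (y : A) :
  (\sum_(i <- r) c i *: D i) y = \sum_(i <- r) c i * D i y :> A.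
Proof.
elim: r => [|i r IH]; first by rewrite !big_nil.
by rewrite !big_cons tangent_funD IH.
Qed.

Lemma tangent_decompE (D : tangent A) (y : A) :
  D y = \sum_(i < n) (D (x i) : A) * partial hx i y :> A.
Proof. by rewrite {1}(tangent_decomp D) tangent_sumE. Qed.

(** Since [y * z = z * y], the two Leibniz expansions of [D (y * z)] agree. *)
Lemma sigma_derivation_swap i (D : A -> A) : sigma_derivation i D ->
  forall y z, D y * (z - tw_sigma A i z) = D z * (y - tw_sigma A i y).
Proof.
case=> _ _ DM y z; have := DM y z; rewrite mulrC DM => e.
rewrite !mulrBr; apply/eqP; rewrite subr_eq addrAC eq_sym subr_eq.
by rewrite (mulrC _ (tw_sigma A i z)) (mulrC _ (tw_sigma A i y)) e.
Qed.

(** The exchange identity of [sigma_derivation_swap] at [x i] and [y], where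
    [partial hx i (x i) = 1]. *)
Lemma tw_sigma_partial i (y : A) :
  tw_sigma A i y = y - defect i * partial hx i y.
Proof.
have := sigma_derivation_swap (partial_sigma_derivation i) (x i) y.
rewrite partial_coord eqxx mul1r => e.
by rewrite mulrC -e subKr.
Qed.

Lemma sub_tw_sigma i (y : A) : y - tw_sigma A i y = defect i * partial hx i y.
Proof. by rewrite tw_sigma_partial subKr. Qed.

(** With [y = x i] in the exchange identity, [D (x j) * defect i] is
    [D (x i) * (x j - tw_sigma A i (x j))], and [x j] is fixed by [tw_sigma A i]
    because its [i]-th partial vanishes. *)
Lemma sigma_derivation_coord0 i j (g : A) (D : A -> A) :
  defect i * g = 1 -> sigma_derivation i D -> j != i -> D (x j) = 0.
Proof.
move=> hg dD ji; have := sigma_derivation_swap dD (x j) (x i).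
rewrite -/(defect i) sub_tw_sigma partial_coord (negPf ji) !mulr0 => e.
by rewrite -[D _]mulr1 -hg mulrA e mul0r.
Qed.

Hypothesis hS : schwarz_type hx.

(** [partial hx i] kills [x j], hence also [tw_sigma A j (x j)], because the
    Schwarz condition lets it pass through [tw_sigma A j]. *)
Lemma partial_defect i j : i != j -> partial hx i (defect j) = 0.
Proof.
move=> ij; have [pD _ _] := partial_sigma_derivation i.
have ji : j != i by rewrite eq_sym.
have e : partial hx i (tw_sigma A j (x j)) = 0 :> A.
  by rewrite -hS.2 // partial_coord eq_sym (negPf ij) rmorph0.
have := pD (defect j) (tw_sigma A j (x j)).
by rewrite subrK e addr0 partial_coord (negPf ji).
Qed.

Lemma tw_sigma_defect i j : i != j -> tw_sigma A i (defect j) = defect j.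
Proof. by move=> ij; rewrite tw_sigma_partial partial_defect // mulr0 subr0. Qed.

Lemma tw_sigma_defect_inv i j (g : A) :
  i != j -> defect j * g = 1 -> tw_sigma A i g = g.
Proof.
move=> ij hg; rewrite -[LHS]mul1r -{1}hg mulrAC -{1}(tw_sigma_defect ij).
by rewrite -rmorphM hg rmorph1 mul1r.
Qed.

End Coordinates.

(** * From actions of derivations to twisted modules *)

Section MicSigma.
Variables (R : comPzRingType) (n : nat) (A : twistedAlgebra R n).
Variables (x : 'I_n -> A) (hx : sigma_coordinates x).

Lemma mic_act_partialM (M : MIC hx) i (c : A) (s : M) :
  mic_act (partial hx i) (c *: s) =
  (partial hx i c : A) *: s + tw_sigma A i c *: mic_act (partial hx i) s.
Proof. exact: (mic_act_der (partial_sigma_derivation hx i)). Qed.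

Lemma mic_actB (M : MIC hx) D (s t : M) :
  mic_act D (s - t) = mic_act D s - mic_act D t.
Proof.
by apply/(canRL (addrK _)); rewrite -(actDr (mic_act_linear M)) subrK.
Qed.

Lemma mic_sigma_linear (M : MIC hx) i : sigma_linear i (mic_sigma M i).
Proof.
rewrite /sigma_linear => a s t /=.
rewrite /mic_sigma -/(defect x i) (actDr (mic_act_linear M)) mic_act_partialM.
rewrite !scalerDr !scalerN !scalerA (mulrC (tw_sigma A i a)).
(* The first Leibniz term turns [a *: s] into [tw_sigma A i a *: s]. *)
have -> : (defect x i * partial hx i a : A) = a - tw_sigma A i a.
  by rewrite -sub_tw_sigma.
rewrite scalerBl -(addrA (a *: s - _)) opprD addrACA subKr opprD (addrCA t).
by rewrite !addrA.
Qed.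

Lemma mic_sigma_hom (M N : MIC hx) (f : mor M N) i (s : M) :
  mic_map f (mic_sigma M i s) = mic_sigma N i (mic_map f s).
Proof. by rewrite /mic_sigma linearB linearZ /= mic_mapP. Qed.

(** The partials span the tangent module and the action is [A]-linear in the
    derivation. *)
Lemma mic_act_decomp (M : MIC hx) D (s : M) :
  mic_act D s = \sum_(i < n) (D (x i) : A) *: mic_act (partial hx i) s.
Proof.
have L := mic_act_linear M.
have act0 : mic_act 0 s = 0.
  by apply: (addrI (mic_act 0 s)); rewrite -(actDl L) !addr0.
rewrite {1}(tangent_decomp hx D).
elim/big_rec2: _ => [//|i t E _ <-].
by rewrite (actDl L) (actZl L).
Qed.

Hypothesis hS : schwarz_type hx.

Lemma mic_sigma_comm (M : MIC hx) i j (s : M) :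
  mic_sigma M i (mic_sigma M j s) = mic_sigma M j (mic_sigma M i s).
Proof.
have [->//|ij] := eqVneq i j.
(* Both Leibniz terms are simple here: [defect x l] is killed by [partial hx k]
   and fixed by [tw_sigma A k]. *)
have expand k l : k != l -> mic_sigma M k (mic_sigma M l s) =
    s - defect x l *: mic_act (partial hx l) s
    - (defect x k *: mic_act (partial hx k) s
       - (defect x k * defect x l) *:
           mic_act (partial hx k) (mic_act (partial hx l) s)).
  move=> kl; rewrite /mic_sigma -!/(defect x _) mic_actB mic_act_partialM.
  by rewrite partial_defect // tw_sigma_defect // scale0r add0r scalerBr scalerA.
have ji : j != i by rewrite eq_sym.
rewrite !expand // mic_act_integrable (mulrC (defect x i)) !opprB !addrA.
by rewrite [LHS]addrAC [RHS]addrAC; congr (_ + _); rewrite addrAC.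
Qed.

End MicSigma.

(** * From twisted modules to actions of derivations *)

Section Inverse.
Variables (R : comPzRingType) (n : nat) (A : twistedAlgebra R n).
Variables (x : 'I_n -> A) (hx : sigma_coordinates x).
Hypothesis hS : schwarz_type hx.
Variables (g : 'I_n -> A) (hg : forall i, defect x i * g i = 1).

Section Objects.
Variable M : TwMod A.

Definition tmod_partial i (s : M) : M := g i *: (s - tmod_sigma i s).

(** The only possible extension of the [tmod_partial i] to the tangent module,
    by [mic_act_decomp]. *)
Definition tmod_act (D : tangent A) (s : M) : M :=
  \sum_(i < n) (D (x i) : A) *: tmod_partial i s.

Lemma tmod_sigmaD i (s t : M) :
  tmod_sigma i (s + t) = tmod_sigma i s + tmod_sigma i t.
Proof. by have := tmod_sigma_linear i 1 s t; rewrite /= rmorph1 !scale1r. Qed.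

Lemma tmod_sigma0 i : tmod_sigma i (0 : M) = 0.
Proof. by apply: (addrI (tmod_sigma i (0 : M))); rewrite -tmod_sigmaD !addr0. Qed.

Lemma tmod_sigmaZ i (c : A) (s : M) :
  tmod_sigma i (c *: s) = tw_sigma A i c *: tmod_sigma i s.
Proof.
by have := tmod_sigma_linear i c s 0; rewrite /= tmod_sigma0 !addr0.
Qed.

Lemma tmod_sigmaB i (s t : M) :
  tmod_sigma i (s - t) = tmod_sigma i s - tmod_sigma i t.
Proof. by apply/(canRL (addrK _)); rewrite -tmod_sigmaD subrK. Qed.

Lemma tmod_partialD i (s t : M) :
  tmod_partial i (s + t) = tmod_partial i s + tmod_partial i t.
Proof. by rewrite /tmod_partial tmod_sigmaD opprD addrACA scalerDr. Qed.

Lemma tmod_partialM i (c : A) (s : M) :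
  tmod_partial i (c *: s) =
  (partial hx i c : A) *: s + tw_sigma A i c *: tmod_partial i s.
Proof.
have -> : partial hx i c = g i * (c - tw_sigma A i c) :> A.
  by rewrite (sub_tw_sigma hx) mulrA (mulrC (g i)) hg mul1r.
rewrite /tmod_partial tmod_sigmaZ -scalerA (scalerA _ (g i)) mulrC.
rewrite -scalerA -scalerDr scalerBl.
by rewrite (scalerBr (tw_sigma A i c)) addrA subrK scalerBr.
Qed.

Lemma tmod_act_partial i (s : M) : tmod_act (partial hx i) s = tmod_partial i s.
Proof.
rewrite /tmod_act (bigD1 i) //= partial_coord eqxx scale1r big1 ?addr0 // => j ji.
by rewrite partial_coord (negPf ji) scale0r.
Qed.

Lemma tmod_act_linear : linear_action tmod_act.
Proof.
split=> [D D' s|D s t|c D s|a D s]; rewrite /tmod_act.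
- by rewrite -big_split; apply: eq_bigr => i _; apply: scalerDl.
- by rewrite -big_split; apply: eq_bigr => i _; rewrite tmod_partialD scalerDr.
- by rewrite scaler_sumr; apply: eq_bigr => i _; rewrite scalerA.
- rewrite scaler_sumr; apply: eq_bigr => i _.
  rewrite /tmod_partial tmod_sigmaZ tw_sigma_unit -scalerBr !scalerA.
  by congr (_ *: _); rewrite mulrAC (mulrC _ (tw_unit A a)).
Qed.

Lemma tmod_act_der : acts_by_derivations tmod_act.
Proof.
move=> i D dD c s.
have D0 j : j != i -> D (x j) = 0 :> A.
  exact: (sigma_derivation_coord0 hx (hg i) dD).
have act1 t : tmod_act D t = (D (x i) : A) *: tmod_partial i t.
  by rewrite /tmod_act (bigD1 i) //= big1 ?addr0 // => j /D0 ->; rewrite scale0r.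
have Dc : D c = (D (x i) : A) * partial hx i c :> A.
  rewrite (tangent_decompE hx) (bigD1 i) //= big1 ?addr0 // => j /D0 ->.
  by rewrite mul0r.
rewrite !act1 tmod_partialM Dc scalerDr !scalerA.
by rewrite (mulrC (D (x i) : A) (tw_sigma A i c)).
Qed.

(** The coefficients [g i] and [g j] come out in front because each is fixed by
    the twist of the other index. *)
Lemma tmod_partial_comm i j (s : M) :
  tmod_partial i (tmod_partial j s) = tmod_partial j (tmod_partial i s).
Proof.
have [->//|ij] := eqVneq i j.
have expand k l : k != l -> tmod_partial k (tmod_partial l s) =
    (g k * g l) *: (s - tmod_sigma l s
                    - (tmod_sigma k s - tmod_sigma k (tmod_sigma l s))).
  move=> kl; rewrite /tmod_partial tmod_sigmaZ.
  rewrite (tw_sigma_defect_inv hS kl (hg l)).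
  by rewrite -scalerBr scalerA tmod_sigmaB.
have ji : j != i by rewrite eq_sym.
rewrite !expand // (mulrC (g i)) (tmod_sigmaC i j) !opprB !addrA.
by congr (_ *: _); rewrite [LHS]addrAC [RHS]addrAC; congr (_ + _); rewrite addrAC.
Qed.

Lemma tmod_act_integrable : integrable hx tmod_act.
Proof. by move=> i j s; rewrite !tmod_act_partial tmod_partial_comm. Qed.

End Objects.

Definition inverse_fobj (M : TwMod A) : MIC hx :=
  MicObj (@tmod_act_linear M) (@tmod_act_der M) (@tmod_act_integrable M).

Lemma inverse_homP (M N : TwMod A) (f : mor M N) D (s : M) :
  tmod_map f (tmod_act D s) = tmod_act D (tmod_map f s).
Proof.
rewrite /tmod_act linear_sum; apply: eq_bigr => i _.
by rewrite linearZ /tmod_partial linearZ linearB /= tmod_mapP.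
Qed.

Definition inverse_fmap (M N : TwMod A) (f : mor M N) :
    mor (inverse_fobj M) (inverse_fobj N) :=
  @MicHom _ _ _ _ hx (inverse_fobj M) (inverse_fobj N) (tmod_map f)
    (@inverse_homP M N f).

Lemma inverse_fmap_id (M : TwMod A) :
  inverse_fmap (idm M) = idm (inverse_fobj M).
Proof. exact: mic_hom_ext. Qed.

Lemma inverse_fmap_comp (M N P : TwMod A) (u : mor N P) (f : mor M N) :
  inverse_fmap (compm u f) = compm (inverse_fmap u) (inverse_fmap f).
Proof. exact: mic_hom_ext. Qed.

Definition inverse_functor : functor (TwMod A) (MIC hx) :=
  Functor inverse_fmap_id inverse_fmap_comp.

(** Solving [mic_sigma M i s = s - defect x i *: d_i s] for [d_i s]. *)
Lemma mic_act_partial_sigma (M : MIC hx) i (s : M) :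
  mic_act (partial hx i) s = g i *: (s - mic_sigma M i s).
Proof.
rewrite /mic_sigma -/(defect x i) subKr scalerA.
by rewrite mulrC hg scale1r.
Qed.

Variable sigmaL : forall (M : MIC hx) i, sigma_linear i (mic_sigma M i).
Variable sigmaC : forall (M : MIC hx) i j (s : M),
  mic_sigma M i (mic_sigma M j s) = mic_sigma M j (mic_sigma M i s).
Variable sigma_hom : forall (M N : MIC hx) (f : mor M N) i (s : M),
  mic_map f (mic_sigma M i s) = mic_sigma N i (mic_map f s).
Let F := sigma_functor sigmaL sigmaC sigma_hom.

Lemma inverse_actE (M : MIC hx) D (s : M) :
  @mic_act _ _ _ _ _ (inverse_functor (F M)) D s = mic_act D s.
Proof.
rewrite (mic_act_decomp D s) /= /tmod_act; apply: eq_bigr => i _.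
by rewrite mic_act_partial_sigma.
Qed.

Lemma sigma_inverseE (M : TwMod A) i (s : M) :
  @tmod_sigma _ _ _ (F (inverse_functor M)) i s = tmod_sigma i s.
Proof.
rewrite /= /mic_sigma /= tmod_act_partial /tmod_partial scalerA.
by rewrite -/(defect x i) hg scale1r subKr.
Qed.

Lemma inverse_sigma_id :
  naturally_isomorphic (functor_comp inverse_functor F) (functor_id (MIC hx)).
Proof.
pose GF := functor_comp inverse_functor F.
pose to (M : MIC hx) : mic_hom (GF M) M :=
  @MicHom _ _ _ _ hx (GF M) M (idfun : {linear GF M -> M}) (@inverse_actE M).
pose from (M : MIC hx) : mic_hom M (GF M) :=
  @MicHom _ _ _ _ hx M (GF M) (idfun : {linear M -> GF M})
    (fun D s => esym (@inverse_actE M D s)).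
exists to; split=> [M N f|M]; first exact: mic_hom_ext.
by exists (from M); split; apply: mic_hom_ext.
Qed.

Lemma sigma_inverse_id :
  naturally_isomorphic (functor_comp F inverse_functor) (functor_id (TwMod A)).
Proof.
pose FG := functor_comp F inverse_functor.
pose to (M : TwMod A) : tmod_hom (FG M) M :=
  @TmodHom _ _ A (FG M) M (idfun : {linear FG M -> M}) (@sigma_inverseE M).
pose from (M : TwMod A) : tmod_hom M (FG M) :=
  @TmodHom _ _ A M (FG M) (idfun : {linear M -> FG M})
    (fun i s => esym (@sigma_inverseE M i s)).
exists to; split=> [M N f|M]; first exact: tmod_hom_ext.
by exists (from M); split; apply: tmod_hom_ext.
Qed.

End Inverse.

(** * The equivalence *)

Theorem corollary6p14 (R : comPzRingType) (n : nat) (A : twistedAlgebra R n)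
    (x : 'I_n -> A) (hx : sigma_coordinates x) (hS : schwarz_type hx) :
  exists (sigmaL : forall (M : MIC hx) (i : 'I_n),
            sigma_linear i (mic_sigma M i))
         (sigmaC : forall (M : MIC hx) (i j : 'I_n) (s : M),
            mic_sigma M i (mic_sigma M j s) = mic_sigma M j (mic_sigma M i s))
         (sigma_hom : forall (M N : MIC hx) (f : mor M N) (i : 'I_n) (s : M),
            mic_map f (mic_sigma M i s) = mic_sigma N i (mic_map f s)),
    strong_coordinates x ->
    is_equivalence (sigma_functor sigmaL sigmaC sigma_hom).
Proof.
exists (@mic_sigma_linear _ _ _ _ hx), (mic_sigma_comm hS).
exists (@mic_sigma_hom _ _ _ _ hx) => /choice[g hg].
exists (inverse_functor hS hg).
by split; [apply: inverse_sigma_id | apply: sigma_inverse_id].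
Qed.
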